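(* Let $F$ be a finite field and let $R=M_2(F)$, regarded as a $*$-ring with an involution $*$. Let $N$ be the set of all non-zero nilpotent elements of $R$. Then $$\Gamma'(R)=\Gamma_1\bigvee_{K_2}K_{|N|},$$ where $\Gamma_1$ is the induced subgraph of $\Gamma^*(R)$ on the set of all non-nilpotent zero-divisors of $R$, and $K_{|N|}$ is the complete graph with vertex set $N$.
   Context: A $*$-ring is a ring $R$ with a map $*:R\to R$ (an involution) satisfying $(x+y)^*=x^*+y^*$, $(xy)^*=y^*x^*$ and $(x^* )^*=x$ for all $x,y\in R$. $Z^*(R)$ denotes the set of all non-zero zero-divisors of $R$ (left or right). The graph $\Gamma^*(R)$ is the simple graph with vertex set $Z^*(R)$ in which two distinct vertices $x,y$ are adjacent if and only if $xy^*=0$. The generalized zero-divisor graph $\Gamma'(R)$ is the simple undirected graph with vertex set $Z^*(R)$ in which two distinct vertices $x,y$ are adjacent if and only if $x^ny^*=0$ or $y^nx^*=0$ for some positive integer $n$. For graphs $G_1,\dots,G_k$ and a graph $H$ with vertex set $\{1,\dots,k\}$, the $H$-generalized join $\bigvee_H\{G_1,\dots,G_k\}$ is the graph obtained by replacing each vertex $i$ of $H$ by the graph $G_i$ and joining every vertex of $G_i$ to every vertex of $G_j$ (for $i\ne j$) if and only if $i$ and $j$ are adjacent in $H$. In particular $G_1\bigvee_{K_2}G_2$ is the graph consisting of the disjoint union of $G_1$ and $G_2$ together with all edges between vertices of $G_1$ and vertices of $G_2$. *)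

(* Defs.v *)
From mathcomp Require Import all_boot all_algebra.
From mathcomp Require Import boolp classical_sets.

Set Implicit Arguments.
Unset Strict Implicit.
Unset Printing Implicit Defensive.

Import GRing.Theory.
Local Open Scope classical_set_scope.
Local Open Scope ring_scope.

Local Obligation Tactic := idtac.

(* Simple graphs whose vertices form a subset of an ambient type T.  As the
   adjacency relation is confined to the vertex set, Leibniz equality of
   [sgraph T] is equality of vertex sets and of adjacency relations (by the
   extensionality principles of boolp). *)
Record sgraph (T : Type) := SGraph {
  vset : set T;
  adj : T -> T -> Prop;
  adj_vset : forall x y, adj x y -> vset x;
  adj_sym : forall x y, adj x y -> adj y x;
  adj_irrefl : forall x, ~ adj x x
}.

Program Definition complete_graph (T : Type) (A : set T) : sgraph T :=
  @SGraph T A (fun x y => [/\ A x, A y & x <> y]) _ _ _.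
Next Obligation. by move=> T A x y []. Qed.
Next Obligation. by move=> T A x y [? ? xy]; split => // /esym. Qed.
Next Obligation. by move=> T A x [_ _]; apply. Qed.

Program Definition induced (T : Type) (G : sgraph T) (A : set T) : sgraph T :=
  @SGraph T (vset G `&` A) (fun x y => [/\ A x, A y & adj G x y]) _ _ _.
Next Obligation. by move=> T G A x y [Ax _ xy]; split => //; exact: adj_vset xy. Qed.
Next Obligation. by move=> T G A x y [Ax Ay xy]; split => //; exact: adj_sym. Qed.
Next Obligation. by move=> T G A x [_ _ xx]; exact: adj_irrefl xx. Qed.

(* The graphs G i live in a common ambient type, so this is the H-generalized
   join when their vertex sets are pairwise disjoint.  The conjunct [x <> y] is
   then redundant; it makes the definition total on arbitrary families. *)
Program Definition gjoin (I T : Type) (H : sgraph I) (G : I -> sgraph T) :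
    sgraph T :=
  @SGraph T (\bigcup_(i in vset H) vset (G i))
    (fun x y =>
      (exists2 i, vset H i & adj (G i) x y) \/
      (exists i j, [/\ adj H i j, vset (G i) x, vset (G j) y & x <> y])) _ _ _.
Next Obligation.
move=> I T H G x y [[i Hi xy]|[i [j [ij xi _ _]]]]; exists i => //.
  exact: adj_vset xy.
exact: adj_vset ij.
Qed.
Next Obligation.
move=> I T H G x y [[i Hi xy]|[i [j [ij xi yj xy]]]].
  by left; exists i => //; exact: adj_sym.
by right; exists j, i; split => //; [exact: adj_sym|move/esym].
Qed.
Next Obligation.
by move=> I T H G x [[i _ xx]|[i [j []]]] //; exact: adj_irrefl xx.
Qed.

Definition K2 : sgraph 'I_2 := complete_graph [set: 'I_2].

Definition join2 (T : Type) (G1 G2 : sgraph T) : sgraph T :=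
  gjoin K2 (fun i => if i == ord0 then G1 else G2).

Record involution (R : pzRingType) := Involution {
  star :> R -> R;
  starD : forall x y, star (x + y) = star x + star y;
  starM : forall x y, star (x * y) = star y * star x;
  starK : forall x, star (star x) = x
}.

Lemma star0 (R : pzRingType) (s : involution R) : s 0 = 0.
Proof. by apply: (@addrI _ (s 0)); rewrite -starD !addr0. Qed.

Definition zero_divisor (R : pzRingType) : set R :=
  [set x | exists2 y, y <> 0 & x * y = 0 \/ y * x = 0].

Definition Zstar (R : pzRingType) : set R :=
  [set x | x <> 0 /\ zero_divisor x].

Definition nilpotent_elt (R : pzRingType) : set R :=
  [set x | exists2 n, (0 < n)%N & x ^+ n = 0].

Program Definition Gamma_star (R : pzRingType) (s : involution R) : sgraph R :=
  @SGraph R (@Zstar R)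
    (fun x y => [/\ Zstar x, Zstar y, x <> y & x * s y = 0]) _ _ _.
Next Obligation. by move=> R s x y []. Qed.
Next Obligation.
move=> R s x y [Zx Zy xy e]; split => //; first by move/esym.
by rewrite -[y](starK s) -starM e star0.
Qed.
Next Obligation. by move=> R s x [_ _ xx _]; exact: xx. Qed.

Program Definition Gamma_prime (R : pzRingType) (s : involution R) : sgraph R :=
  @SGraph R (@Zstar R)
    (fun x y => [/\ Zstar x, Zstar y, x <> y &
       exists2 n, (0 < n)%N & x ^+ n * s y = 0 \/ y ^+ n * s x = 0]) _ _ _.
Next Obligation. by move=> R s x y []. Qed.
Next Obligation.
move=> R s x y [Zx Zy xy [n n0 e]]; split => //; first by move/esym.
by exists n => //; case: e; [right|left].
Qed.
Next Obligation. by move=> R s x [_ _ xx _]; exact: xx. Qed.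

(* Main.v *)
Require Import Defs.
From mathcomp Require Import all_boot all_algebra.
From mathcomp Require Import boolp classical_sets.
From mathcomp Require Import ring.
Local Open Scope classical_set_scope.
Local Open Scope ring_scope.

Import GRing.Theory.

(* A zero-divisor x of M_2(F) has determinant 0, so by Cayley-Hamilton
   x^2 = tr(x) x and x^(n+1) = tr(x)^n x.  If x is nilpotent then x^2 = 0 and x
   is adjacent to every other vertex of Gamma'; otherwise tr(x) is invertible,
   so x^n y^* = 0 is equivalent to x y^* = 0. *)

(** The remaining fields are proofs, which proof irrelevance identifies once the vertex sets and the
    adjacency relations are equal. *)
Lemma sgraph_eq (T : Type) (G H : sgraph T) :
  vset G = vset H -> (forall x y, adj G x y <-> adj H x y) -> G = H.
Proof.
case: G H => [V a p1 p2 p3] [W b q1 q2 q3] /= eVW eab.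
have {}eab : a = b by apply/funext => x; apply/funext => y; apply/propext.
subst W b; congr SGraph; exact: Prop_irrelevance.
Qed.

Lemma adj_join2 (T : Type) (G1 G2 : sgraph T) (x y : T) :
  adj (join2 G1 G2) x y <->
  [\/ adj G1 x y, adj G2 x y,
      [/\ vset G1 x, vset G2 y & x <> y] | [/\ vset G2 x, vset G1 y & x <> y]].
Proof.
split=> [[[i _]|[i [j [[_ _ ij]]]]]|].
- by case: eqP => _ xy; [constructor 1|constructor 2].
- case: (eqVneq i ord0) => i0; case: (eqVneq j ord0) => j0 xG yG xy.
  + by case: ij; rewrite i0 j0.
  + by constructor 3.
  + by constructor 4.
  (* Two nonzero indices in ['I_2] are both 1, whereas [K2] has no loop. *)
  + case: ij; apply/val_inj; move: i0 j0.
    by case: i {xG} => [[|[|i]] //= ?]; case: j {yG} => [[|[|j]] //= ?].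
case=> [xy|xy|xy|xy].
- by left; exists ord0.
- by left; exists (lift ord0 ord0).
- by right; exists ord0, (lift ord0 ord0); case: xy.
- by right; exists (lift ord0 ord0), ord0; case: xy.
Qed.

Lemma vset_join2 (T : Type) (G1 G2 : sgraph T) :
  vset (join2 G1 G2) = vset G1 `|` vset G2.
Proof.
apply/seteqP; split => [x [i _]|x [xG|xG]].
- by case: ifP => _ xG; [left|right].
- by exists ord0.
- by exists (lift ord0 ord0).
Qed.

Lemma zero_divisor_nonunit (R : unitRingType) (x : R) :
  zero_divisor x -> x \isn't a GRing.unit.
Proof.
move=> [y y0 xy]; apply/negP => ux; apply: y0; case: xy => xy.
  by apply: (mulrI ux); rewrite xy mulr0.
by apply: (mulIr ux); rewrite xy mul0r.
Qed.

(** The witness is the last nonzero power of [x]; for [x = 0] this is [x ^+ 0 = 1]. *)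
Lemma nilpotent_zero_divisor (R : nzRingType) (x : R) :
  nilpotent_elt x -> zero_divisor x.
Proof.
case; elim=> // n IHn _; case: (eqVneq (x ^+ n) 0) => [xn0 _|xn0 xSn0].
  case: n IHn xn0 => [_ /eqP|n IHn]; first by rewrite expr0 oner_eq0.
  exact: IHn.
by exists (x ^+ n); [apply/eqP | left; rewrite -exprS].
Qed.

(** Once the determinant is written out, each of the four entries is a polynomial identity in the
    coefficients of [x]. *)
Lemma Cayley_Hamilton2 (R : comNzRingType) (x : 'M[R]_2) :
  x * x = \tr x *: x - (\det x)%:M.
Proof.
have l0 : lift ord0 ord0 = 1 :> 'I_2 by apply/val_inj.
have l1 : lift 1 ord0 = 0 :> 'I_2 by apply/val_inj.
have -> : \det x = x 0 0 * x 1 1 - x 0 1 * x 1 0.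
  rewrite (expand_det_row x 0) !big_ord_recl big_ord0 addr0 /cofactor !det_mx11.
  by rewrite !mxE l0 l1 expr0 expr1 mul1r mulN1r mulrN.
apply/matrixP => i j; rewrite /mxtrace !mxE !big_ord_recl !big_ord0 l0.
have [->|->] : i = 0 \/ i = 1.
  by case: i => [[|[|i]] // ?]; [left|right]; apply/val_inj.
all: have [->|->] : j = 0 \/ j = 1
  by case: j => [[|[|j]] // ?]; [left|right]; apply/val_inj.
all: rewrite /= ?mulr1n ?mulr0n; ring.
Qed.

Lemma zero_divisor_exprS (F : fieldType) (x : 'M[F]_2) n :
  zero_divisor x -> x ^+ n.+1 = \tr x ^+ n *: x.
Proof.
move=> /zero_divisor_nonunit; rewrite unitmxE unitfE negbK => /eqP dx0.
elim: n => [|n IHn]; first by rewrite expr1 expr0 scale1r.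
rewrite exprS IHn -scalerAr Cayley_Hamilton2 dx0 raddf0 subr0 scalerA.
by rewrite -exprSr.
Qed.

(** If tr(x)^n x = 0, then tr(x) = 0 or x = 0, and x = 0 has trace 0 as well. Conversely, trace 0
    gives x^2 = tr(x) x = 0. *)
Lemma zero_divisor_nilpotentP (F : fieldType) (x : 'M[F]_2) :
  zero_divisor x -> nilpotent_elt x <-> \tr x = 0.
Proof.
move=> zx; split=> [[[//|n] _]|tx0].
  rewrite zero_divisor_exprS // => /eqP; rewrite scaler_eq0.
  case/orP=> [|/eqP ->]; last by rewrite raddf0.
  by rewrite expf_eq0 => /andP[_ /eqP].
by exists 2%N; rewrite // zero_divisor_exprS // tx0 expr1 scale0r.
Qed.

Lemma nilpotent_sqr0 (F : fieldType) (x : 'M[F]_2) :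
  nilpotent_elt x -> x ^+ 2 = 0.
Proof.
move=> nx; have zx := nilpotent_zero_divisor _ _ nx.
rewrite zero_divisor_exprS // (zero_divisor_nilpotentP _ x zx).1 //.
by rewrite expr1 scale0r.
Qed.

Lemma nonnilpotent_expr_mul0 (F : fieldType) (x y : 'M[F]_2) n :
  zero_divisor x -> ~ nilpotent_elt x -> (0 < n)%N -> x ^+ n * y = 0 ->
  x * y = 0.
Proof.
move=> zx nx; case: n => // n _; rewrite zero_divisor_exprS // -scalerAl.
move=> /eqP; rewrite scaler_eq0 => /orP[|/eqP//].
by rewrite expf_eq0 => /andP[_ /eqP /(zero_divisor_nilpotentP _ x zx).2].
Qed.

Theorem theorem2p17 (F : finFieldType) (s : involution 'M[F]_2) :
  let N : set 'M[F]_2 := [set x | x <> 0 /\ nilpotent_elt x] in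
  let Gamma1 : sgraph 'M[F]_2 :=
    induced (Gamma_star s) [set x | zero_divisor x /\ ~ nilpotent_elt x] in
  vset Gamma1 `&` vset (complete_graph N) = set0 /\
  Gamma_prime s = join2 Gamma1 (complete_graph N).
Proof.
move=> N Gamma1.
have NZ x : N x -> Zstar x.
  by move=> [x0 nx]; split=> //; exact: nilpotent_zero_divisor.
(* Since x^2 = 0, exponent 2 works whatever [s y] is. This gives both the edges inside [N] and those
   between [N] and [Gamma1]. *)
have NadjP x y : N x -> Zstar y -> x <> y -> adj (Gamma_prime s) x y.
  move=> Nx Zy xy; split=> //; first exact: NZ.
  by exists 2%N => //; left; rewrite nilpotent_sqr0 ?mul0r //; case: Nx.
(* Disjointness of the vertex sets makes [join2] a genuine join here. *)
split; first by apply/seteqP; split=> // x [[_ [_ nx]] [_ /nx]].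
apply: sgraph_eq => [|x y].
  rewrite vset_join2; apply/seteqP; split=> [x [x0 zx]|x [[]|/NZ]] //.
  by case: (pselect (nilpotent_elt x)) => nx; [right|left].
rewrite adj_join2; split=> [|[[_ _ [Zx Zy xy e]]|[Nx /NZ Zy xy]|[[Zx _] Ny xy]|[Nx [Zy _] xy]]].
- move=> [[x0 zx] [y0 zy] xy [n n0 e]].
  (* Only when neither [x] nor [y] is nilpotent does the equation [e] matter; in the other cases the
     join supplies the edge. *)
  case: (pselect (nilpotent_elt x)) => nx;
    case: (pselect (nilpotent_elt y)) => ny.
  + by constructor 2.
  + by constructor 4.
  + by constructor 3.
  + constructor 1; split=> //; split=> //; case: e => e.
      exact: (nonnilpotent_expr_mul0 _ _ _ n).
    (* The exponent is removed on the side of [y]; applying the involution to y x^* = 0 then gives x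
       y^* = 0. *)
    have yx : y * s x = 0 by apply: (nonnilpotent_expr_mul0 _ _ _ n).
    by rewrite -[x](starK s) -starM yx star0.
(* Conversely, an edge of [Gamma1] needs only exponent 1, and the other three kinds of edges come
   from [NadjP]. *)
- by split=> //; exists 1%N => //; left; rewrite expr1.
- exact: NadjP.
- by apply/adj_sym/NadjP => // /esym.
- exact: NadjP.
Qed.
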